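(* Given a simply connected symplectic manifold $(M,\omega)$ with compatible almost complex structure $J$, the Maslov index $\widetilde{\mathfrak{m}}_{\mathfrak{s}^2}(\tilde\gamma)$ of a loop $\tilde\gamma:S^1\to\Lambda_J$ does not depend on the choice of a global section $\mathfrak{s}^2$ of $\Gamma_J^2$.
   Context: Let $\dim M=2n$. $J$ is compatible with $\omega$ if $g_J(u,v)=\omega(Ju,v)$ is a Riemannian metric. A unitary frame of $T_pM$ is a basis $(u_1,\dots,u_n,v_1,\dots,v_n)$ with $v_i=-Ju_i$, $g_J(u_i,u_j)=\delta_{ij}$, $g_J(u_i,v_j)=0$. $\mathbb{U}(n)$ is identified with the real matrices $C=\begin{bmatrix} A & -B \\ B & A \end{bmatrix}$ with $A+iB$ unitary, acts on frames from the right, and $\det_{\mathbb C}C=\det(A+iB)$; $\mathbb{O}(n)=\{B=0\}$, $\mathbb{EU}(n)=\{\det_{\mathbb C}=\pm1\}$. $Fr^u_J\to M$ is the principal bundle of unitary frames, $\Lambda_J=Fr^u_J/\mathbb{O}(n)$ is the Lagrangian plane bundle, and $\Gamma_J^2=Fr^u_J/\mathbb{EU}(n)$ is a principal $S^1$ bundle over $M$ with inherent action $[f]\cdot z=[f\cdot C]$ for any $C$ with $(\det_{\mathbb C}C)^2=z$. $det_J^2:\Lambda_J\to\Gamma_J^2$ is the natural quotient map. A global section $\mathfrak{s}^2:M\to\Gamma_J^2$ induces the trivialization $tr_{\mathfrak{s}^2}:\Gamma_J^2\to M\times S^1$, $\mathfrak{s}^2(p)\cdot z\mapsto(p,z)$.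 The (Maslov) index $\widetilde{\mathfrak{m}}_{\mathfrak{s}^2}(\tilde\gamma)$ of a loop $\tilde\gamma:S^1\to\Lambda_J$ is the degree of the map $pr_{S^1}\circ tr_{\mathfrak{s}^2}\circ det_J^2\circ\tilde\gamma:S^1\to S^1$. *)

(* Defs.v *)
(* An arbitrary [R : realType] plays the role of the real numbers. *)
From HB Require Import structures.
From mathcomp Require Import all_boot all_order all_algebra spectral generic_quotient.
From mathcomp Require Import all_classical all_reals all_analysis.
From mathcomp Require Import complex.

Set Implicit Arguments.
Unset Strict Implicit.
Unset Printing Implicit Defensive.
Import Order.TTheory GRing.Theory Num.Theory.
Import numFieldNormedType.Exports.
Local Open Scope classical_set_scope.
Local Open Scope ring_scope.

Section Smooth.
Variables (R : realType) (m : nat).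
Implicit Types (U : set 'rV[R]_m) (f : 'rV[R]_m -> R).

Definition evec (a : 'I_m) : 'rV[R]_m := delta_mx 0 a.

(* [U] is open in every use, so continuity and derivatives at the points of
   [U] only involve the values of [f] on [U]. *)
Fixpoint Ck_on (k : nat) U f : Prop :=
  {in U, continuous f} /\
  if k is k'.+1 then
    (forall x a, U x -> derivable f x (evec a)) /\
    (forall a, Ck_on k' U ('D_(evec a) f))
  else True.

Definition smooth_on U f := forall k, Ck_on k U f.

End Smooth.

(* A smooth manifold given by an atlas.  Charts and their inverses are total
   functions; only their values on [chart_dom i] and on its image matter. *)
Record smoothManifold (R : realType) (m : nat) := SmoothManifold {
  mf_space :> topologicalType;
  mf_hausdorff : hausdorff_space mf_space;
  mf_second_countable : @second_countable mf_space;
  chart_idx : Type;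
  chart_dom : chart_idx -> set mf_space;
  chart : chart_idx -> mf_space -> 'rV[R]_m;
  chart_inv : chart_idx -> 'rV[R]_m -> mf_space;
  chart_dom_open : forall i, open (chart_dom i);
  chart_dom_cover : forall p, exists i, chart_dom i p;
  chart_img_open : forall i, open (chart i @` chart_dom i);
  chartK : forall i p, chart_dom i p -> chart_inv i (chart i p) = p;
  chart_continuous : forall i, {within chart_dom i, continuous (chart i)};
  chart_inv_continuous : forall i,
    {within chart i @` chart_dom i, continuous (chart_inv i)};
  transition_smooth : forall i j (k : 'I_m),
    smooth_on (chart i @` (chart_dom i `&` chart_dom j))
      (fun x => chart j (chart_inv i x) 0 k)
}.

Section Tangent.
Variables (R : realType) (m : nat) (M : smoothManifold R m).

Definition transition (i j : chart_idx M) : 'rV[R]_m -> 'rV[R]_m :=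
  chart j \o chart_inv i.

(* A tangent vector at [p] is the family of its coordinate vectors in the
   charts around [p], related by the differentials of the transition maps; the
   components at charts not containing [p] are set to 0. *)
Definition tangent_pred (p : M) : {pred chart_idx M -> 'rV[R]_m} := fun v =>
  `[< (forall i, ~ chart_dom i p -> v i = 0) /\
      (forall i j, chart_dom i p -> chart_dom j p ->
         v j = 'd (transition i j) (chart i p) (v i)) >].

Lemma tangent_subsemimod_closed p : GRing.subsemimod_closed (tangent_pred p).
Proof.
split; first split.
- apply/asboolP; split=> // i j _ _.
  by rewrite /GRing.zero /= linear0.
- move=> u v /asboolP[u0 uE] /asboolP[v0 vE]; apply/asboolP; split=> [i pi|i j pi pj].
    by rewrite /GRing.add /= u0// v0// addr0.
  by rewrite /GRing.add /= (uE i j)// (vE i j)// linearD.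
- move=> a v /asboolP[v0 vE]; apply/asboolP; split=> [i pi|i j pi pj].
    by rewrite /GRing.scale /= v0// scaler0.
  by rewrite /GRing.scale /= (vE i j)// linearZ.
Qed.

HB.instance Definition _ p :=
  GRing.isSubSemiModClosed.Build R _ (tangent_pred p)
    (tangent_subsemimod_closed p).

Record tangent (p : M) := Tangent {
  tcoord :> chart_idx M -> 'rV[R]_m;
  _ : tcoord \in tangent_pred p
}.

HB.instance Definition _ p := [isSub for @tcoord p].
HB.instance Definition _ p := [Choice of tangent p by <:].
HB.instance Definition _ p := [SubChoice_isSubLmodule of tangent p by <:].

Definition chart_img (i : chart_idx M) : set 'rV[R]_m := chart i @` chart_dom i.

Definition tensor2 := forall p : M, tangent p -> tangent p -> R.

Definition bilinear_tensor (t : tensor2) :=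
  (forall p v, scalar (fun u : tangent p => t p u v)) /\
  (forall p u, scalar (fun v : tangent p => t p u v)).

(* [W a b] is the coefficient of [t] on the coordinate fields a, b of chart i *)
Definition tensor2_expr (t : tensor2) (i : chart_idx M)
    (W : 'I_m -> 'I_m -> 'rV[R]_m -> R) :=
  (forall a b, smooth_on (chart_img i) (W a b)) /\
  (forall p (u v : tangent p), chart_dom i p ->
     t p u v = \sum_a \sum_b u i 0 a * v i 0 b * W a b (chart i p)).

Definition smooth_tensor2 (t : tensor2) :=
  bilinear_tensor t /\ forall i, exists W, tensor2_expr t i W.

Definition closed_form (t : tensor2) := forall i W, tensor2_expr t i W ->
  forall x, chart_img i x -> forall a b c : 'I_m,
  'D_(evec R a) (W b c) x + 'D_(evec R b) (W c a) x + 'D_(evec R c) (W a b) x = 0.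

Record symplectic_form := SymplecticForm {
  symp :> forall p : M, tangent p -> tangent p -> R;
  symp_smooth : smooth_tensor2 symp;
  symp_alternating : forall p (u : tangent p), symp u u = 0;
  symp_nondegenerate : forall p (u : tangent p),
    (forall v, symp u v = 0) -> u = 0;
  symp_closed : closed_form symp
}.

Definition riemannian_metric (g : tensor2) :=
  [/\ smooth_tensor2 g,
      forall p (u v : tangent p), g p u v = g p v u &
      forall p (u : tangent p), u <> 0 -> 0 < g p u u].

Record almost_complex := AlmostComplex {
  acs :> forall p : M, tangent p -> tangent p;
  acs_linear : forall p, linear (@acs p);
  acs_square : forall p (u : tangent p), acs (acs u) = - u;
  acs_smooth : forall i, exists W : 'I_m -> 'I_m -> 'rV[R]_m -> R,
    (forall a b, smooth_on (chart_img i) (W a b)) /\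
    (forall p (u : tangent p), chart_dom i p ->
       forall b, acs u i 0 b = \sum_a u i 0 a * W a b (chart i p))
}.

Definition acs_metric (omega : symplectic_form) (J : almost_complex) : tensor2 :=
  fun p u v => omega p (J p u) v.

Definition compatible (omega : symplectic_form) (J : almost_complex) :=
  riemannian_metric (acs_metric omega J).

End Tangent.

Definition simply_connected (R : realType) (T : topologicalType) :=
  let I := `[0, 1]%classic : set R in
  (forall x y : T, exists f : R -> T,
     [/\ {within I, continuous f}, f 0 = x & f 1 = y]) /\
  (forall (x : T) (f : R -> T), {within I, continuous f} -> f 0 = x -> f 1 = x ->
     exists H : R * R -> T,
     [/\ {within I `*` I, continuous H},
         forall t, I t -> H (0, t) = f t,
         forall t, I t -> H (1, t) = x &
         forall s, I s -> H (s, 0) = x /\ H (s, 1) = x]).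

(* The numClosedFieldType alias gives the complex numbers their norm topology. *)
Definition Cplx (R : realType) : numClosedFieldType := R[i].

Section Circle.
Variable R : realType.

(* set_type: carries the subspace topology *)
Definition S1 : Type := set_type [set z : Cplx R | `|z| = 1].
HB.instance Definition _ := Topological.on S1.

Definition cis (t : R) : Cplx R := (cos (2 * pi * t) +i* sin (2 * pi * t))%C.

Lemma cis_subproof t : cis t \in [set z : Cplx R | `|z| = 1].
Proof.
rewrite inE /=; rewrite normc_def /= cos2Dsin2 sqrtr1.
by [].
Qed.

(* [circ t] is exp (2 pi i t) *)
Definition circ (t : R) : S1 := exist _ (cis t) (cis_subproof t).

(* [d] is the degree of [h]: the winding number of a continuous real lift *)
Definition is_degree (h : S1 -> S1) (d : int) :=
  exists theta : R -> R,
  [/\ {within `[0, 1], continuous theta},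
      forall t, t \in `[0, 1] -> h (circ t) = circ (theta t) &
      theta 1 - theta 0 = d%:~R].

(* the unique such integer; meaningful for continuous [h] *)
Definition degree (h : S1 -> S1) : int := xget 0 [set d | is_degree h d].

End Circle.

Section UnitaryGroup.
Variables (R : realType) (n : nat).
Implicit Types (A B : 'M[R]_n) (C : 'M[R]_(n + n)).

Definition cpx_mx A B : 'M[Cplx R]_n := \matrix_(i, j) (A i j +i* B i j)%C.

Definition real_mx A B : 'M[R]_(n + n) := block_mx A (- B) B A.

Definition detC C : Cplx R := \det (cpx_mx (ulsubmx C) (dlsubmx C)).

Definition unitary_group : set 'M[R]_(n + n) := [set C |
  exists A B, C = real_mx A B /\ cpx_mx A B \is unitarymx].

Definition orthogonal_group : set 'M[R]_(n + n) :=
  unitary_group `&` [set C | dlsubmx C = 0].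

Definition eu_group : set 'M[R]_(n + n) :=
  unitary_group `&` [set C | detC C = 1 \/ detC C = - 1].

Definition subgroup_mx (K : set 'M[R]_(n + n)) :=
  [/\ K 1%:M, forall C D, K C -> K D -> K (C *m D) &
      forall C, K C -> exists D, K D /\ C *m D = 1%:M].

Lemma cpx_mx1 : cpx_mx 1%:M 0 = 1%:M.
Proof. by apply/matrixP => i j; rewrite !mxE; case: eqP. Qed.

Lemma sum_cpx (f g : 'I_n -> R) :
  \sum_k ((f k +i* g k)%C : Cplx R) = ((\sum_k f k) +i* (\sum_k g k))%C.
Proof.
elim: (index_enum _) => [|k s IHs]; first by rewrite !big_nil.
by rewrite !big_cons IHs.
Qed.

Lemma cpx_mxM A B A' B' :
  cpx_mx A B *m cpx_mx A' B' = cpx_mx (A *m A' - B *m B') (A *m B' + B *m A').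
Proof.
apply/matrixP => i j; rewrite !mxE -sumrB -big_split /= -sum_cpx.
by apply: eq_bigr => k _; rewrite !mxE.
Qed.

Lemma real_mxM A B A' B' :
  real_mx A B *m real_mx A' B' = real_mx (A *m A' - B *m B') (A *m B' + B *m A').
Proof.
rewrite /real_mx mulmx_block !mulmxN !mulNmx -opprD.
by rewrite [B *m A' + _]addrC [- _ + _]addrC.
Qed.

Lemma real_mx1 : real_mx 1%:M 0 = 1%:M.
Proof. by rewrite /real_mx oppr0 -scalar_mx_block. Qed.

Lemma cpx_mx_adj A B : cpx_mx A^T (- B^T) = map_mx Num.conj (cpx_mx A B)^T.
Proof. by apply/matrixP => i j; rewrite !mxE. Qed.

Lemma detC_real_mx A B : detC (real_mx A B) = \det (cpx_mx A B).
Proof. by rewrite /detC /real_mx block_mxKul block_mxKdl. Qed.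

Lemma cpx_mx_inj A B A' B' : cpx_mx A B = cpx_mx A' B' -> A = A' /\ B = B'.
Proof.
move=> /matrixP E; split; apply/matrixP => i j; have := E i j; rewrite !mxE.
  by case.
by case.
Qed.

Lemma unitary_inv A B : cpx_mx A B \is unitarymx ->
  [/\ cpx_mx A^T (- B^T) \is unitarymx,
      cpx_mx A B *m cpx_mx A^T (- B^T) = 1%:M &
      real_mx A B *m real_mx A^T (- B^T) = 1%:M].
Proof.
move=> u; rewrite cpx_mx_adj trmxC_unitary (unitarymxP u); split=> //.
move/unitarymxP: u; rewrite -cpx_mx_adj cpx_mxM real_mxM -cpx_mx1.
by move=> /cpx_mx_inj[-> ->]; rewrite real_mx1.
Qed.

Lemma unitary_group_subgroup : subgroup_mx unitary_group.
Proof.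
split.
- exists 1%:M, 0; rewrite real_mx1 cpx_mx1; split=> //.
  by apply/unitarymxP; rewrite mul1mx trmx1 map_mx1.
- move=> _ _ [A [B [-> u]]] [A' [B' [-> u']]]; rewrite real_mxM.
  by do 2 eexists; split; first reflexivity; rewrite -cpx_mxM mul_unitarymx.
- move=> _ [A [B [-> /unitary_inv[u _ AB]]]].
  by exists (real_mx A^T (- B^T)); split=> //; exists A^T, (- B^T).
Qed.

Lemma orthogonal_group_subgroup : subgroup_mx orthogonal_group.
Proof.
have [u1 uM uV] := unitary_group_subgroup; split.
- by split=> //=; rewrite -real_mx1 block_mxKdl.
- move=> C D [uC oC] [uD oD]; split; first exact: uM.
  move: uC uD oC oD => [A [B [-> _]]] [A' [B' [-> _]]] /=.
  by rewrite real_mxM !block_mxKdl => -> ->; rewrite mulmx0 mul0mx addr0.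
- move=> _ [[A [B [-> /unitary_inv[u _ AB]]]] /=]; rewrite block_mxKdl => B0.
  exists (real_mx A^T (- B^T)); split=> //; split; first by exists A^T, (- B^T).
  by rewrite /= block_mxKdl B0 trmx0 oppr0.
Qed.

Lemma eu_group_subgroup : subgroup_mx eu_group.
Proof.
have [u1 uM uV] := unitary_group_subgroup; split.
- by split=> //=; left; rewrite -real_mx1 detC_real_mx cpx_mx1 det1.
- move=> C D [uC dC] [uD dD]; split; first exact: uM.
  move: uC uD dC dD => [A [B [-> _]]] [A' [B' [-> _]]] /=.
  rewrite real_mxM !detC_real_mx -cpx_mxM det_mulmx.
  by move=> [->|->] [->|->]; rewrite ?mul1r ?mulN1r ?opprK; [left|right|right|left].
- move=> _ [[A [B [-> /unitary_inv[u AB1 AB]]]] /=]; rewrite detC_real_mx => dC.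
  exists (real_mx A^T (- B^T)); split=> //; split; first by exists A^T, (- B^T).
  have := congr1 determinant AB1; rewrite /= detC_real_mx det_mulmx det1.
  case: dC => ->; first by rewrite mul1r => ->; left.
  by rewrite mulN1r => /eqP; rewrite eqr_oppLR => /eqP ->; right.
Qed.

Lemma orthogonal_sub_eu : orthogonal_group `<=` eu_group.
Proof.
move=> _ [[A [B [-> u]]] /=]; rewrite block_mxKdl => B0; split.
  by exists A, B.
have [_ AB _] := unitary_inv u.
have trE : cpx_mx A^T (- B^T) = (cpx_mx A B)^T.
  by rewrite B0; apply/matrixP => i j; rewrite !mxE oppr0.
have := congr1 determinant AB; rewrite /= detC_real_mx trE det_mulmx det_tr det1.
by rewrite -expr2 => /eqP; rewrite sqrf_eq1 => /orP[]/eqP->; [left|right].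
Qed.

End UnitaryGroup.

Section Frames.
Variables (R : realType) (n : nat) (M : smoothManifold R (n + n)).
Implicit Types (C : 'M[R]_(n + n)).

Definition pframe : Type := {p : M & 'I_(n + n) -> tangent p}.

Definition fbasis (p : M) (f : 'I_(n + n) -> tangent p) :=
  forall v : tangent p, exists! c : 'rV[R]_(n + n), v = \sum_j c 0 j *: f j.

(* u_i is at index [lshift n i] and v_i at index [rshift n i] *)
Definition unitary_frame (omega : symplectic_form M) (J : almost_complex M)
    (F : pframe) :=
  let p := projT1 F in let f := projT2 F in
  let u i := f (lshift n i) in let v i := f (rshift n i) in
  let g := @acs_metric _ _ M omega J p in
  [/\ fbasis f,
      forall i, v i = - J p (u i),
      forall i j, g (u i) (u j) = (i == j)%:R &
      forall i j, g (u i) (v j) = 0].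

(* right action: the row of frame vectors times the matrix [C] *)
Definition frame_act (F : pframe) C : pframe :=
  existT _ (projT1 F) (fun j => \sum_i C i j *: projT2 F i).

Definition frame_coord (i : chart_idx M) (F : pframe) : 'M[R]_(n + n) :=
  \matrix_(j, k) projT2 F j i 0 k.

Lemma frame_act1 F : frame_act F 1%:M = F.
Proof.
case: F => p f; congr existT; apply/funext => j /=.
rewrite (bigD1 j) //= !mxE eqxx scale1r big1 ?addr0// => k kj.
by rewrite !mxE (negbTE kj) scale0r.
Qed.

Lemma frame_actM F C D : frame_act (frame_act F C) D = frame_act F (C *m D).
Proof.
case: F => p f; congr existT; apply/funext => j /=.
under eq_bigr do rewrite scaler_sumr.
rewrite exchange_big /=; apply: eq_bigr => k _.
rewrite !mxE scaler_suml; apply: eq_bigr => l _.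
by rewrite scalerA mulrC.
Qed.

Variables (omega : symplectic_form M) (J : almost_complex M).

Definition Fr : Type := {F : pframe | `[< unitary_frame omega J F >]}.
HB.instance Definition _ := gen_eqMixin Fr.
HB.instance Definition _ := gen_choiceMixin Fr.

Definition fr_base (F : Fr) : M := projT1 (val F).

(* The topology of the frame bundle is generated by the local trivializations
   F |-> (base point of F, matrix of F) over the chart domains. *)
Definition fr_subbase : set (set Fr) := [set V |
  exists (i : chart_idx M) (O : set (M * 'M[R]_(n + n))), open O /\
  V = [set F : Fr | chart_dom i (fr_base F) /\
                    O (fr_base F, frame_coord i (val F))]].

HB.instance Definition _ := @isSubBaseTopological.Build Fr
  (set Fr) fr_subbase id.

Definition orbit_rel (K : set 'M[R]_(n + n)) : rel Fr := fun F F' =>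
  `[< exists2 C, K C & val F' = frame_act (val F) C >].

Lemma orbit_rel_equiv K : subgroup_mx K -> equiv_class_of (orbit_rel K).
Proof.
move=> [K1 KM KV].
have sym F F' : orbit_rel K F F' -> orbit_rel K F' F.
  move=> /asboolP[C KC E]; have [D [KD CD]] := KV _ KC; apply/asboolP.
  by exists D; rewrite // E frame_actM CD frame_act1.
split.
- by move=> F; apply/asboolP; exists 1%:M; rewrite ?frame_act1.
- by move=> F F'; apply/idP/idP; exact: sym.
- move=> F G H /asboolP[C KC E] /asboolP[D KD E']; apply/asboolP.
  by exists (C *m D); [exact: KM|rewrite E' E frame_actM].
Qed.

Definition orth_rel : equiv_rel Fr :=
  EquivRelPack (orbit_rel_equiv (@orthogonal_group_subgroup R n)).
Definition eu_rel : equiv_rel Fr :=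
  EquivRelPack (orbit_rel_equiv (@eu_group_subgroup R n)).

Local Open Scope quotient_scope.

Definition Lambda : Type := quotient_topology {eq_quot orth_rel}.
HB.instance Definition _ := Topological.on Lambda.
HB.instance Definition _ := Quotient.on Lambda.

Definition Gamma2 : Type := quotient_topology {eq_quot eu_rel}.
HB.instance Definition _ := Topological.on Gamma2.
HB.instance Definition _ := Quotient.on Gamma2.

Definition gamma_base (x : Gamma2) : M := fr_base (repr x).

(* the quotient map [f] |-> [f], see [det2_pi] *)
Definition det2 (x : Lambda) : Gamma2 := \pi_Gamma2 (repr x).

Lemma det2_pi (F : Fr) : det2 (\pi_Lambda F) = \pi_Gamma2 F.
Proof.
apply/eqmodP; have /eqmodP/asboolP[C OC E] : repr (\pi_Lambda F) = F %[mod Lambda].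
  by rewrite reprK.
by apply/asboolP; exists C => //; exact: orthogonal_sub_eu.
Qed.

(* [gamma_act x z y] is the graph of the circle action, y = x . z:
   [f] . z = [f C] for any C in U(n) with (det C)^2 = z *)
Definition gamma_act (x : Gamma2) (z : S1 R) (y : Gamma2) : Prop :=
  exists (F F' : Fr) (C : 'M[R]_(n + n)),
    [/\ unitary_group C, detC C ^+ 2 = val z,
        val F' = frame_act (val F) C, x = \pi_Gamma2 F & y = \pi_Gamma2 F'].

Record global_section := GlobalSection {
  gsec :> M -> Gamma2;
  gsec_continuous : continuous gsec;
  gsec_base : forall p, gamma_base (gsec p) = p
}.

(* s(p) . z |-> (p, z); the default value is never reached *)
Definition trivialization (s : global_section) (y : Gamma2) : M * S1 R :=
  xget (gamma_base y, circ 0) [set pz | gamma_act (s pz.1) pz.2 y].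

Definition maslov_index (s : global_section) (gamma : S1 R -> Lambda) : int :=
  degree (snd \o trivialization s \o det2 \o gamma).

End Frames.

(* Main.v *)
(* Let w(p) be the element of the circle with s'(p) = s(p).w(p).  The circle-valued
   maps of a loop gamma of Lagrangian planes computed from s and from s' differ
   by the factor w o base o gamma.  As base o gamma is a null-homotopic loop in M,
   this factor has a continuous logarithm that takes the same value at both ends;
   adding it to a lift for s' gives a lift for s of the same degree.  For the
   continuity of w, no local sections are needed: Fr -> Gamma^2 is open, and the
   matrix relating two unitary frames of T_pM has entries g_J(f_i, f'_j), which
   are continuous in the chart coordinates of the two frames. *)
From HB Require Import structures.
Require Import Defs.
From mathcomp Require Import all_boot all_order all_algebra.
From mathcomp Require Import all_classical all_reals all_analysis.
From mathcomp Require Import complex ring lra.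

Set Implicit Arguments.
Unset Strict Implicit.
Unset Printing Implicit Defensive.
Import Order.TTheory GRing.Theory Num.Theory.
Import numFieldNormedType.Exports.
Local Open Scope classical_set_scope.
Local Open Scope ring_scope.

(** * Unitary frames *)

Section UnitaryMatrices.
Variables (R : realType) (n : nat).
Implicit Types (A B : 'M[R]_n) (C D : 'M[R]_(n + n)).

Lemma real_mx_inj A B A' B' : real_mx A B = real_mx A' B' -> A = A' /\ B = B'.
Proof. by move=> /eq_block_mx[-> _ -> _]. Qed.

Lemma tr_real_mx A B : (real_mx A B)^T = real_mx A^T (- B^T).
Proof. by rewrite /real_mx tr_block_mx linearN/= opprK. Qed.

Lemma unitary_group_trK C : unitary_group C -> C^T *m C = 1%:M.
Proof.
by move=> [A [B [-> /unitary_inv[_ _ AB]]]]; rewrite tr_real_mx mulmx1C.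
Qed.

(** Transposing [real_mx A B] amounts to taking the adjoint of [A + iB], so the blocks of the
    orthogonality relation are the real and imaginary parts of the unitarity relation. *)
Lemma unitary_groupP A B :
  (real_mx A B)^T *m real_mx A B = 1%:M -> unitary_group (real_mx A B).
Proof.
rewrite tr_real_mx real_mxM -real_mx1 => /real_mx_inj[ReE ImE].
exists A, B; split=> //; apply/unitarymxP; rewrite -cpx_mx_adj; apply: mulmx1C.
by rewrite cpx_mxM ReE ImE cpx_mx1.
Qed.

Lemma detCM C D : unitary_group C -> unitary_group D ->
  detC (C *m D) = detC C * detC D.
Proof.
move=> [A [B [-> _]]] [A' [B' [-> _]]].
by rewrite real_mxM !detC_real_mx -cpx_mxM det_mulmx.
Qed.

Lemma eu_detC_sqr C : eu_group C -> detC C ^+ 2 = 1.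
Proof. by move=> [_ [->|->]]; rewrite ?sqrrN expr1n. Qed.

End UnitaryMatrices.

Section UnitaryFrames.
Variables (R : realType) (n : nat) (M : smoothManifold R (n + n)).
Variables (omega : symplectic_form M) (J : almost_complex M).
Hypothesis hJ : compatible omega J.

Let g := @acs_metric _ _ M omega J.

Lemma acs_metricC p (u v : tangent p) : g u v = g v u.
Proof. by have [_ gC _] := hJ; exact: gC. Qed.

Lemma acs_metricP p (v : tangent p) : scalar (fun u : tangent p => g v u).
Proof. by have [[[_ gr] _] _ _] := hJ; exact: gr. Qed.

Lemma acs_metric_sumr p (v : tangent p) (c : 'I_(n + n) -> R) f :
  g v (\sum_i c i *: f i) = \sum_i c i * g v (f i).
Proof.
have gD : {morph g v : x y / x + y}.
  by move=> x y; rewrite -[x in LHS]scale1r acs_metricP mul1r.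
have g0 : g v 0 = 0.
  by apply: (addrI (g v 0)); rewrite -gD !addr0.
rewrite (big_morph _ gD g0); apply: eq_bigr => i _.
by rewrite -[_ *: _]addr0 acs_metricP g0 addr0.
Qed.

(** Polarization: expand [omega p (u + v) (u + v) = 0]. *)
Lemma symp_anti p (u v : tangent p) : omega p u v = - omega p v u.
Proof.
have [[ol or] _] := symp_smooth omega.
have oD x y : omega p (x + y) (x + y) = omega p x x + omega p y x + (omega p x y + omega p y y).
  have := or p (x + y) 1 x y; rewrite /= scale1r mul1r => ->.
  have := ol p x 1 x y; rewrite /= scale1r mul1r => ->.
  by have := ol p y 1 x y; rewrite /= scale1r mul1r => ->.
have := oD u v; rewrite !symp_alternating add0r addr0 => /esym/eqP.
by rewrite addrC addr_eq0 => /eqP.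
Qed.

Lemma acs_sum p (c : 'I_n -> R) (f : 'I_n -> tangent p) :
  J p (\sum_i c i *: f i) = \sum_i c i *: J p (f i).
Proof.
pose Jlin : {linear tangent p -> tangent p} :=
  HB.pack (J p) (GRing.isLinear.Build R _ _ _ (J p) (acs_linear J (p := p))).
rewrite -[J p]/(Jlin : _ -> _) linear_sum.
by apply: eq_bigr => i _; rewrite linearZ.
Qed.

Lemma acsN p (u : tangent p) : J p (- u) = - J p u.
Proof.
pose Jlin : {linear tangent p -> tangent p} :=
  HB.pack (J p) (GRing.isLinear.Build R _ _ _ (J p) (acs_linear J (p := p))).
exact: (linearN Jlin u).
Qed.

Lemma acsD p (u v : tangent p) : J p (u + v) = J p u + J p v.
Proof. by rewrite -[u in LHS]scale1r acs_linear scale1r. Qed.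

(** Since [J] squares to -1, the left side is [- omega u (J v) = omega (J v) u = g v u], and [g] is
    symmetric. *)
Lemma acs_metricJ p (u v : tangent p) : g (J p u) (J p v) = g u v.
Proof.
rewrite [RHS]acs_metricC /g /acs_metric acs_square.
rewrite symp_anti.
have [[ol or] _] := symp_smooth omega.
have := or p (J p v) (-1) u 0; rewrite /= scaleN1r addr0 => ->.
have -> : omega p (J p v) 0 = 0.
  by have := or p (J p v) (-1) 0 0; rewrite /= scaler0 addr0 mulN1r addNr.
by rewrite addr0 mulN1r opprK.
Qed.

Lemma acs_metric_swap p (u v : tangent p) : g (J p u) v = - g u (J p v).
Proof.
rewrite -acs_metricJ acs_square acs_metricC.
have := acs_metricP (J p v) (-1) u 0; rewrite scaleN1r addr0 => ->.
have := acs_metric_sumr (J p v) (fun=> 0) (fun=> 0).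
rewrite big1 => [->|i _]; last by rewrite scale0r.
by rewrite big1 => [|i _]; rewrite ?mul0r// addr0 mulN1r acs_metricC.
Qed.

Lemma acs_metricNr p (u v : tangent p) : g u (- v) = - g u v.
Proof.
by rewrite -(acs_square J) -[LHS]opprK -acs_metric_swap acs_metricJ.
Qed.

(** The definition of a unitary frame prescribes only the products u-u and u-v. The products v-u
    follow by symmetry, and v-v because [v_i = - J u_i] and [J] is an isometry. *)
Lemma unitary_frame_orthonormal p (f : 'I_(n + n) -> tangent p) :
  unitary_frame omega J (existT _ p f) ->
  forall i j, g (f i) (f j) = (i == j)%:R.
Proof.
case=> /= _ fJ uu uv i j.
case: (split_ordP i) (split_ordP j) => {}i -> [] {}j ->.
- by rewrite (inj_eq (@lshift_inj _ _)); exact: uu.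
- by rewrite eq_lrshift; exact: uv.
- by rewrite eq_rlshift acs_metricC; exact: uv.
- rewrite (inj_eq (@rshift_inj _ _)) !fJ acs_metricNr acs_metricC acs_metricNr.
  by rewrite opprK acs_metricJ acs_metricC; exact: uu.
Qed.

(** Pairing with an orthonormal frame reads off coefficients. The transition matrix is thus unique
    and computable from the metric; the first gives injectivity of the action, the second continuity
    of the section ratio. *)
Lemma frame_act_gram p (f f' : 'I_(n + n) -> tangent p) (C : 'M[R]_(n + n)) :
  unitary_frame omega J (existT _ p f) ->
  (forall j, f' j = \sum_i C i j *: f i) ->
  forall i j, C i j = g (f i) (f' j).
Proof.
move=> /unitary_frame_orthonormal fo f'E i j.
rewrite f'E acs_metric_sumr (bigD1 i)//= fo eqxx mulr1 big1 ?addr0// => k ki.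
by rewrite fo eq_sym (negbTE ki) mulr0.
Qed.

(** The Gram matrix of [f] against [f'] is the transition matrix. It is orthogonal because both
    frames are orthonormal, and has the block shape of [real_mx] because [v_i = - J u_i] holds in
    both and [J] is an isometry. *)
Lemma unitary_frames_related p (f f' : 'I_(n + n) -> tangent p) :
  unitary_frame omega J (existT _ p f) -> unitary_frame omega J (existT _ p f') ->
  exists2 C, unitary_group C & existT _ p f' = frame_act (existT _ p f) C.
Proof.
move=> uf uf'; pose C := \matrix_(i, j) g (f i) (f' j).
have f'E j : f' j = \sum_i C i j *: f i.
  have [fb _ _ _] := uf; have [c [cE _]] := fb (f' j).
  rewrite cE; apply: eq_bigr => i _; congr (_ *: _).
  (* To treat the single vector [f' j], the lemma is applied to a constant family, with a matrix all
     of whose columns are [c]. *)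
  have := @frame_act_gram p f (fun=> f' j) (\matrix_(i, _) c 0 i) uf _ i j.
  rewrite !mxE; apply=> k; rewrite {1}cE.
  by apply: eq_bigr => l _; rewrite mxE.
exists C; last by congr existT; apply/funext => j; rewrite f'E.
have CC : C^T *m C = 1%:M.
  apply/matrixP => i j; rewrite !mxE -(unitary_frame_orthonormal uf').
  rewrite [f' j]f'E acs_metric_sumr; apply: eq_bigr => k _.
  by rewrite !mxE acs_metricC mulrC.
have CE : C = real_mx (ulsubmx C) (dlsubmx C).
  rewrite -[LHS]submxK; have [/= _ fJ _ _] := uf; have [/= _ fJ' _ _] := uf'.
  congr block_mx; apply/matrixP => i j; rewrite !mxE /=.
    rewrite fJ' fJ acs_metricNr; congr (- _).
    by rewrite [RHS]acs_metricC acs_metricNr [in RHS]acs_metricC acs_metric_swap opprK.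
  by rewrite fJ' fJ acs_metricNr acs_metricC acs_metricNr opprK acs_metricJ acs_metricC.
by rewrite CE; apply: unitary_groupP; rewrite -CE.
Qed.

Lemma lincomb_frame_act (p : M) (f : 'I_(n + n) -> tangent p) (C : 'M[R]_(n + n))
    (c : 'rV[R]_(n + n)) :
  \sum_j c 0 j *: (\sum_i C i j *: f i) = \sum_i (c *m C^T) 0 i *: f i.
Proof.
under eq_bigr do rewrite scaler_sumr.
rewrite exchange_big /=; apply: eq_bigr => i _.
rewrite mxE scaler_suml; apply: eq_bigr => j _.
by rewrite scalerA mxE.
Qed.

Lemma unitary_frame_act F C :
  unitary_frame omega J F -> unitary_group C -> unitary_frame omega J (frame_act F C).
Proof.
case: F => p f uf uC; have CC := unitary_group_trK uC.
have fo := unitary_frame_orthonormal uf; have [/= fb fJ _ _] := uf.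
have o i j : g (\sum_k C k i *: f k) (\sum_k C k j *: f k) = (i == j)%:R.
  have /matrixP/(_ i j) := CC; rewrite !mxE => <-.
  rewrite acs_metric_sumr; apply: eq_bigr => k _; rewrite mxE mulrC; congr (_ * _).
  by rewrite acs_metricC (@frame_act_gram p f (fun j => \sum_l C l j *: f l) C uf).
split=> /=.
- move=> v; have [c [cE cU]] := fb v; exists (c *m C); split=> [|d dE].
    by rewrite lincomb_frame_act -mulmxA (mulmx1C CC) mulmx1.
  by rewrite (cU (d *m C^T)) -?mulmxA ?CC ?mulmx1// -lincomb_frame_act.
(* The block shape of [C] enters here: it makes [C] commute with the matrix of [J] in the frame
   [f]. *)
- move=> i; have [A [B [-> _]]] := uC.
  have Jr k : J p (f (rshift n k)) = f (lshift n k) by rewrite fJ acsN acs_square opprK.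
  have Jl k : J p (f (lshift n k)) = - f (rshift n k) by rewrite fJ opprK.
  rewrite !big_split_ord /= acsD !acs_sum opprD addrC -!sumrN.
  congr (_ + _); apply: eq_bigr => k _.
    by rewrite block_mxEdr block_mxEul Jl scalerN opprK.
  by rewrite block_mxEur block_mxEdl Jr mxE scaleNr.
- by move=> i j; rewrite -(inj_eq (@lshift_inj n n)); exact: o.
- by move=> i j; rewrite [LHS]o eq_lrshift.
Qed.

End UnitaryFrames.

(** * Logarithms of circle-valued loops *)

Section CplxContinuity.
Variable R : realType.
Implicit Types z : Cplx R.

Lemma normc_ge_Im_real (x y : R) : (`|y|%:C)%C <= `|(x +i* y)%C : Cplx R|.
Proof.
rewrite normc_def lecR -sqrtr_sqr ler_wsqrtr//= lerDr.
exact: sqr_ge0.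
Qed.

Lemma normc_ge_Re_real (x y : R) : (`|x|%:C)%C <= `|(x +i* y)%C : Cplx R|.
Proof.
rewrite normc_def lecR -sqrtr_sqr ler_wsqrtr//= lerDl.
exact: sqr_ge0.
Qed.

Lemma continuous_Re : continuous (@complex.Re R : Cplx R -> R).
Proof.
move=> z; apply/(@cvgrPdist_lt _ R _ _ (nbhs_filter z)) => e e0.
have e0' : (0 : Cplx R) < e%:C%C by rewrite ltcR.
near=> z'; have h : `|z - z'| < e%:C%C.
  near: z'; have := @cvgr_dist_lt (Cplx R) (Cplx R) _ (nbhs z) (nbhs_filter z) id z cvg_id _ e0'; exact.
move: h; case: (z) => x y; case: (z') => x' y' h.
by rewrite -ltcR; apply: le_lt_trans h; exact: normc_ge_Re_real.
Unshelve. all: by end_near. Qed.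

Lemma continuous_Im : continuous (@complex.Im R : Cplx R -> R).
Proof.
move=> z; apply/(@cvgrPdist_lt _ R _ _ (nbhs_filter z)) => e e0.
have e0' : (0 : Cplx R) < e%:C%C by rewrite ltcR.
near=> z'; have h : `|z - z'| < e%:C%C.
  near: z'; have := @cvgr_dist_lt (Cplx R) (Cplx R) _ (nbhs z) (nbhs_filter z) id z cvg_id _ e0'; exact.
move: h; case: (z) => x y; case: (z') => x' y' h.
by rewrite -ltcR; apply: le_lt_trans h; exact: normc_ge_Im_real.
Unshelve. all: by end_near. Qed.

Lemma cvg_complex (T : Type) (F : set_system T) (FF : Filter F) (f g : T -> R)
    (a b : R) :
  f @ F --> a -> g @ F --> b ->
  (fun x => (f x +i* g x)%C : Cplx R) @ F --> ((a +i* b)%C : Cplx R).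
Proof.
(* A positive element of [Cplx R] has zero imaginary part, so the bound is a real number that can be
   halved between the two components. *)
move=> fa gb; apply/cvgrPdist_lt => -[e e'] /=; rewrite ltcE /= => /andP[/eqP-> e0].
have e20 : 0 < e / 2 by rewrite divr_gt0.
have na := @cvgr_dist_lt _ _ _ _ FF _ _ fa _ e20.
have nb := @cvgr_dist_lt _ _ _ _ FF _ _ gb _ e20.
apply: filterS2 na nb => x ha hb.
have -> : ((a +i* b) - (f x +i* g x))%C =
   ((a - f x) +i* 0)%C + (0 +i* (b - g x))%C :> Cplx R.
  by apply/eqP; rewrite eq_complex /=; apply/andP; split; apply/eqP; ring.
apply: le_lt_trans (ler_normD _ _) _.
rewrite !normc_def /= expr0n /= addr0 add0r !sqrtr_sqr.
rewrite -[_ + _]/((_ +i* _)%C) ltcE/= addr0 eqxx/=; lra.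
Qed.

End CplxContinuity.

Section ContinuousLog.
Variable R : realType.
Implicit Types (z : Cplx R) (t : R).

Lemma cis0 : cis (0 : R) = 1.
Proof. by rewrite /cis mulr0 cos0 sin0. Qed.

Lemma cisD (a b : R) : cis (a + b) = cis a * cis b.
Proof.
rewrite /cis mulrDr cosD sinD; apply/eqP; rewrite eq_complex /=.
by rewrite eqxx addrC [sin _ * _]mulrC/= mulrC [cos _ * sin _]mulrC; apply/eqP; ring.
Qed.

(* The half-angle formula for the argument, in turns. *)
Definition clog z : R := pi^-1 * atan (complex.Im z / (1 + complex.Re z)).

Lemma unit_normP z : `|z| = 1 -> complex.Re z ^+ 2 + complex.Im z ^+ 2 = 1.
Proof.
rewrite normc_def => /eqP; rewrite eq_complex /= => /andP[/eqP h _].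
by rewrite -[LHS]sqr_sqrtr ?h ?expr1n// addr_ge0 ?sqr_ge0.
Qed.

Lemma Re_neqN1 z : `|z| = 1 -> z != -1 -> 0 < 1 + complex.Re z.
Proof.
move=> /unit_normP; case: z => x y /= h; rewrite eq_complex /= oppr0 => hz.
rewrite lt_neqAle; apply/andP; split; last by nra.
apply: contraNN hz => /eqP h0.
have -> : x = -1 by lra.
by rewrite eqxx -sqrf_eq0; apply/eqP; nra.
Qed.

(** With [u = y / (1 + x)], the relation [x^2 + y^2 = 1] gives [1 + u^2 = 2 / (1 + x)], hence
    [cos (atan u) ^+ 2 = (1 + x) / 2]; doubling the angle [atan u] then returns [x] and [y]. *)
Lemma clogK z : `|z| = 1 -> z != -1 -> cis (clog z) = z.
Proof.
move=> z1 zN1; have x0 := Re_neqN1 z1 zN1; have := unit_normP z1.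
case: z z1 zN1 x0 => x y _ _ /= x0 h.
rewrite /cis /clog /=; set u := y / (1 + x).
have -> : 2 * pi * (pi^-1 * atan u) = atan u + atan u :> R.
  by rewrite mulrA -[2 * pi * _]mulrA mulfV ?gt_eqF ?pi_gt0// mulr1 mulr_natl mulr2n.
have c0 : cos (atan u) != 0 by rewrite cos_atan invr_eq0 sqrtr_eq0 -ltNge ltr_wpDr ?sqr_ge0.
have su : sin (atan u) = u * cos (atan u).
  by rewrite -[u in u * _]atanK /tan divfK.
have c2 : cos (atan u) ^+ 2 = (1 + x) / 2.
  rewrite cos_atan exprVn sqr_sqrtr ?addr_ge0 ?sqr_ge0//.
  have -> : 1 + u ^+ 2 = 2 / (1 + x).
    rewrite /u expr_div_n; have -> : y ^+ 2 = (1 - x) * (1 + x) by lra.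
    by field; rewrite lt0r_neq0.
  by rewrite invf_div.
rewrite cosD sinD su.
apply/eqP; rewrite eq_complex /=.
set c := cos _ in c2 *.
have -> : c * c - u * c * (u * c) = (1 - u ^+ 2) * c ^+ 2 by ring.
have -> : u * c * c + c * (u * c) = 2 * u * c ^+ 2 by ring.
rewrite c2 /u; apply/andP; split; apply/eqP; last by field; rewrite lt0r_neq0.
rewrite expr_div_n; have -> : y ^+ 2 = (1 - x) * (1 + x) by lra.
by field; rewrite lt0r_neq0.
Qed.

Lemma continuous_clog z : `|z| = 1 -> z != -1 -> {for z, continuous clog}.
Proof.
move=> z1 zN1; have x0 := Re_neqN1 z1 zN1.
apply: (@cvgM _ _ _ (nbhs_filter z)); first exact: cvg_cst.
apply: (@continuous_comp _ _ _ (fun z => complex.Im z / (1 + complex.Re z)) (@atan R)).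
  apply: (@cvgM _ _ _ (nbhs_filter z)); first exact: continuous_Im.
  apply: (@cvgV _ _ _ (nbhs_filter z)); first by rewrite lt0r_neq0.
  by apply: (@cvgD _ _ _ _ (nbhs_filter z)); [exact: cvg_cst|exact: continuous_Re].
exact: continuous_atan.
Qed.

Lemma cis_surj z : `|z| = 1 -> exists t, cis t = z.
Proof.
move=> z1; have [->|zN1] := eqVneq z (-1); last by exists (clog z); exact: clogK.
exists 2^-1; rewrite /cis.
have -> : 2 * pi * 2^-1 = pi :> R by field.
by rewrite cospi sinpi; apply/eqP; rewrite eq_complex /= oppr0 !eqxx.
Qed.

(** A logarithm in turns that closes up, which is to say that [g] has winding number 0 on the unit
    interval. Continuity of [phi] on the whole line avoids subspace topologies; the lifting equation
    concerns only the interval. *)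
Definition loop_log (g : R -> Cplx R) (phi : R -> R) :=
  [/\ continuous phi, phi 0 = phi 1 &
      forall t, `[0, 1]%classic t -> g t = cis (phi t)].

(* The ratio of the two loops stays away from -1, where [clog] is discontinuous. *)
Lemma loop_log_near (g h : R -> Cplx R) phi :
  continuous g -> continuous h ->
  (forall t, `|g t| = 1) -> (forall t, `|h t| = 1) ->
  g 0 = g 1 -> h 0 = h 1 ->
  (forall t, `|g t - h t| < 1) ->
  loop_log g phi -> exists psi, loop_log h psi.
Proof.
move=> cg ch g1 h1 g01 h01 gh [cphi phi01 gE].
have q1 t : `|h t / g t| = 1 by rewrite normrM normfV g1 h1 divr1.
have g0 t : g t != 0 by rewrite -normr_gt0 g1.
have qN1 t : h t / g t != -1.
  apply/eqP => hgN; have hg : h t = - g t by rewrite -[h t](divfK (g0 t)) hgN mulN1r.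
  have := gh t; rewrite hg opprK -mulr2n normrMn g1.
  by rewrite ltrn1.
exists (fun t => clog (h t / g t) + phi t); split.
- move=> t; apply: cvgD; last exact: cphi.
  apply: (@continuous_comp _ _ _ (fun t => h t / g t) clog).
    by apply: cvgM; [exact: ch|apply: cvgV => //; exact: cg].
  exact: continuous_clog.
- by rewrite phi01 g01 h01.
- by move=> t It; rewrite cisD clogK// -gE// divfK.
Qed.

(** The retraction of the line onto the unit interval. It extends a homotopy from the unit square to
    the whole plane. *)
Definition clamp t : R := Num.max 0 (Num.min 1 t).

Lemma clamp_itv t : `[0, 1]%classic (clamp t).
Proof. by rewrite /= in_itv /= le_max lexx ge_max ler01 ge_min lexx. Qed.

Lemma clamp_id t : `[0, 1]%classic t -> clamp t = t.
Proof. by rewrite /= in_itv /= => /andP[t0 t1]; rewrite /clamp min_r// max_r. Qed.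

Lemma continuous_clamp : continuous clamp.
Proof.
move=> t; apply: continuous_max; first exact: cvg_cst.
by apply: continuous_min; [exact: cvg_cst|exact: cvg_id].
Qed.

(** Compactness of the unit square reduces this to a local claim: for [y] near [x] and [N] large,
    both values of [g] are close to [g x]. The shifted point may leave the square, hence [g] is
    continuous on the whole plane. *)
Lemma uniform_first_variable (g : R * R -> Cplx R) : continuous g ->
  exists N : nat, forall s t, `[0, 1]%classic s -> `[0, 1]%classic t ->
    `|g (s, t) - g (s + N.+1%:R^-1, t)| < 1.
Proof.
move=> cg.
have /compact_near_coveringP/(_ nat \oo (fun N x => `|g x - g (x.1 + N.+1%:R^-1, x.2)| < 1)) :
    compact (`[0, 1]%classic `*` `[0, 1]%classic : set (R * R)).
  by apply: compact_setX; exact: segment_compact.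
case=> [x _|N _ /(_ _ (leqnn N)) h]; last by exists N => s t Is It; apply: (h (s, t)).
pose f (y : (R * R) * nat) := g (y.1.1 + y.2.+1%:R^-1, y.1.2).
pose F := filter_prod (nbhs x) \oo.
have FF : Filter F by exact: filter_prod_filter.
have cx : (fun y : (R * R) * nat => y.1) @ F --> x by exact: cvg_fst.
have cn : (fun y : (R * R) * nat => y.2) @ F --> \oo by exact: cvg_snd.
have c11 : (fun y : (R * R) * nat => y.1.1) @ F --> x.1.
  by apply: cvg_comp cx _; case: (x) => x1 x2; exact: cvg_fst.
have c12 : (fun y : (R * R) * nat => y.1.2) @ F --> x.2.
  by apply: cvg_comp cx _; case: (x) => x1 x2; exact: cvg_snd.
have c1 : (fun y : (R * R) * nat => g y.1) @ F --> g x.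
  exact: (continuous_cvg FF (cg x) cx).
have cN : (fun y : (R * R) * nat => y.2.+1%:R^-1 : R) @ F --> (0 : R).
  exact: (cvg_comp _ _ cn (@cvg_harmonic R)).
have c2 : f @ F --> g x.
  apply: (continuous_cvg FF (cg x)).
  have c11N : (fun y : (R * R) * nat => y.1.1 + y.2.+1%:R^-1) @ F --> x.1.
    by rewrite -[X in _ --> X]addr0; exact: (@cvgD _ _ _ F FF _ _ _ _ c11 cN).
  by have := @cvg_pair _ _ _ _ _ _ FF _ _ _ _ c11N c12; case: (x) => x1 x2; exact.
have c3 : (fun y : (R * R) * nat => g y.1 - f y) @ F --> (0 : Cplx R).
  by rewrite -(subrr (g x)); exact: (@cvgB _ _ _ F FF _ _ _ _ c1 c2).
have := @cvgr_dist_lt _ _ _ F FF _ _ c3 1 ltr01.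
by apply: filterS => y /=; rewrite sub0r normrN.
Qed.

(** The homotopy parameter is cut into [N.+1] equal steps, so short that consecutive loops differ by
    less than 1; [loop_log_near] then carries the logarithm from each loop to the next. *)
Lemma homotopy_loop_log (g : R * R -> Cplx R) :
  continuous g -> (forall x, `|g x| = 1) ->
  (forall s t, g (s, t) = g (s, clamp t)) ->
  (forall s, g (s, 0) = g (s, 1)) ->
  (exists phi, loop_log (fun t => g (0, t)) phi) ->
  (exists phi, loop_log (fun t => g (1, t)) phi).
Proof.
move=> cg g1 gclamp g01 base.
have [N gN] := uniform_first_variable cg.
have cgs s : continuous (fun t => g (s, t)).
  move=> t; apply: (@continuous_comp _ _ _ (fun t => (s, t)) g); last exact: cg.
  exact: (@cvg_pair _ _ _ (nbhs t) (nbhs s) (nbhs t) _ _ _ _ _ (cvg_cst s) cvg_id).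
have step k : (k <= N.+1)%N ->
    exists phi, loop_log (fun t => g (k%:R / N.+1%:R, t)) phi.
  elim: k => [|k IHk] kN; first by rewrite mul0r.
  have [phi hphi] := IHk (ltnW kN).
  apply: (loop_log_near _ _ _ _ _ _ _ hphi) => // t.
  (* The bound is wanted for every real [t]; clamping brings [t] into the unit interval, where the
     uniform estimate holds. *)
  rewrite -[k.+1%:R]natr1 mulrDl div1r gclamp [g (_ + _, _)]gclamp; apply: gN; last exact: clamp_itv.
  by rewrite /= in_itv /= divr_ge0//= ler_pdivrMr// mul1r ler_nat ltnW.
by have := step _ (leqnn N.+1); rewrite divff// pnatr_eq0.
Qed.

End ContinuousLog.

(** * Topology of the frame bundle *)

Section Convergence.
Variables (K : numFieldType) (T : Type) (F : set_system T).
Hypothesis FF : Filter F.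

Lemma cvg_mx_entry m n (f : T -> 'M[K]_(m, n)) (l : 'M[K]_(m, n)) :
  (forall i j, (fun x => f x i j) @ F --> l i j) -> f @ F --> l.
Proof.
move=> fl A [P lP sPA]; have : F [set x | forall i j, P i j (f x i j)].
  apply: (@filter_forall T _ (fun i x => forall j, P i j (f x i j)) F FF) => i.
  by apply: (@filter_forall T _ (fun j x => P i j (f x i j)) F FF) => j; exact/fl/lP.
by apply: (@filterS _ F FF) => x Px; exact: (sPA (f x)).
Qed.

Lemma cvg_sum_fin (I : finType) (f : I -> T -> K) (l : I -> K) :
  (forall i, f i @ F --> l i) -> (fun x => \sum_i f i x) @ F --> \sum_i l i.
Proof. by move=> fl; exact: (@cvg_big K I +%R 0 xpredT (@add_continuous K) T F _ f l FF (fun i _ => fl i)). Qed.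

Lemma cvg_prod_fin (I : finType) (f : I -> T -> K) (l : I -> K) :
  (forall i, f i @ F --> l i) -> (fun x => \prod_i f i x) @ F --> \prod_i l i.
Proof. by move=> fl; exact: (@cvg_big K I *%R 1 xpredT (@mul_continuous K) T F _ f l FF (fun i _ => fl i)). Qed.

Lemma cvg_entry m n (f : T -> 'M[K]_(m, n)) (l : 'M[K]_(m, n)) i j :
  f @ F --> l -> (fun x => f x i j) @ F --> l i j.
Proof. by move=> fl; exact: (continuous_cvg FF (@coord_continuous K m n i j l) fl). Qed.

Lemma cvg_det n (f : T -> 'M[K]_n) (l : 'M[K]_n) :
  f @ F --> l -> (fun x => \det (f x)) @ F --> \det l.
Proof.
move=> fl; apply: cvg_sum_fin => s; apply: (@cvgM _ _ _ FF); first exact: cvg_cst.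
by apply: cvg_prod_fin => i; exact: cvg_entry.
Qed.

End Convergence.

Lemma cvg_detC (R : realType) n (T : Type) (F : set_system T) (FF : Filter F)
    (f : T -> 'M[R]_(n + n)) (l : 'M[R]_(n + n)) :
  f @ F --> l -> (fun x => detC (f x)) @ F --> detC l.
Proof.
move=> fl; apply: (@cvg_det (Cplx R) T F FF n); apply: cvg_mx_entry => i j.
under eq_cvg do rewrite !mxE; rewrite !mxE.
by apply: cvg_complex; exact: cvg_entry.
Qed.

Section FrameBundle.
Variables (R : realType) (n : nat) (M : smoothManifold R (n + n)).
Variables (omega : symplectic_form M) (J : almost_complex M).
Local Notation Fr := (Fr omega J).

Lemma open_fr_subbase (V : set Fr) : fr_subbase V -> open V.
Proof.
move=> sV; exists [set V]; last by rewrite bigcup_set1.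
by move=> _ ->; exact: finI_from1.
Qed.

Lemma continuous_to_Fr (T : topologicalType) (f : T -> Fr) :
  (forall V, fr_subbase V -> open (f @^-1` V)) -> continuous f.
Proof.
move=> fV; apply/continuousP => A [D DA <-].
rewrite preimage_bigcup; apply: bigcup_open => B /DA[E ED <-].
rewrite preimage_bigcap openE => x xE; apply: filter_bigI => V VE.
by apply: open_nbhs_nbhs; split; [exact/fV/set_mem/ED|exact: xE].
Qed.

Lemma continuous_fr_base : continuous (@fr_base R n M omega J).
Proof.
apply/continuousP => U oU.
(* The charts cover [M], and over each chart domain the preimage is subbasic, with a condition on
   the base point alone. *)
have -> : @fr_base R n M omega J @^-1` U = \bigcup_i
    [set F : Fr | chart_dom i (fr_base F) /\ (fst @^-1` U) (fr_base F, frame_coord i (val F))].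
  apply/seteqP; split=> [F /= UF|F [i _ /= []]//].
  by have [i iF] := chart_dom_cover (fr_base F); exists i.
apply: bigcup_open => i _; apply: open_fr_subbase; exists i, (fst @^-1` U).
by split=> //; apply: open_comp oU => x _; exact: cvg_fst.
Qed.

Lemma fr_trivialization_continuous i (F0 : Fr) : chart_dom i (fr_base F0) ->
  {for F0, continuous (fun F : Fr => (fr_base F, frame_coord i (val F)))}.
Proof.
move=> iF0 V; rewrite /= nbhsE => -[W [oW WF0] WV].
have oW' : open [set F : Fr | chart_dom i (fr_base F) /\ W (fr_base F, frame_coord i (val F))].
  by apply: open_fr_subbase; exists i, W.
have := open_nbhs_nbhs (conj oW' (conj iF0 WF0)).
by apply: filterS => F [_ /WV].
Qed.

Lemma tcoord_sum (p : M) (I : finType) (c : I -> R) (f : I -> tangent p) i k :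
  (\sum_l c l *: f l : tangent p) i 0 k = \sum_l c l * f l i 0 k.
Proof.
have D : {morph (fun u : tangent p => u i 0 k) : u v / u + v}.
  by move=> u v; have /= -> : tcoord (u + v) i = tcoord u i + tcoord v i by []; rewrite mxE.
have Z : (0 : tangent p) i 0 k = 0 by have -> : tcoord (0 : tangent p) i = 0 by []; rewrite mxE.
rewrite (big_morph _ D Z).
apply: eq_bigr => l _; have -> : tcoord (c l *: f l) i = c l *: tcoord (f l) i by [].
by rewrite mxE.
Qed.

Lemma frame_coord_act i (F : pframe M) C :
  frame_coord i (frame_act F C) = C^T *m frame_coord i F.
Proof.
apply/matrixP => j k; rewrite !mxE /= tcoord_sum.
by apply: eq_bigr => l _; rewrite !mxE.
Qed.

Hypothesis hJ : compatible omega J.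

(** The default [F] makes the action total on all matrices; for unitary [C] it is never reached, by
    [unitary_frame_act]. *)
Definition fr_act (C : 'M[R]_(n + n)) (F : Fr) : Fr := insubd F (frame_act (val F) C).

Lemma val_fr_act C F : unitary_group C -> val (fr_act C F) = frame_act (val F) C.
Proof.
move=> uC; rewrite insubdK//; apply/asboolP/unitary_frame_act => //.
exact/asboolP/(valP F).
Qed.

(** Frame vectors are the rows of [frame_coord], so in a chart the right action by [C] is left
    multiplication by [C^T]. Preimages of subbasic sets are therefore subbasic over the same
    chart. *)
Lemma fr_act_continuous C : unitary_group C -> continuous (fr_act C).
Proof.
move=> uC; apply: continuous_to_Fr => _ [i [W [oW ->]]].
pose h (x : M * 'M[R]_(n + n)) : M * 'M[R]_(n + n) := (x.1, C^T *m x.2).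
apply: open_fr_subbase; exists i, (h @^-1` W); split.
  apply: open_comp oW => x _.
  have c2 : (fun y : M * 'M[R]_(n + n) => C^T *m y.2) @ x --> C^T *m x.2.
    apply: cvg_mx_entry => j k; under eq_cvg do rewrite mxE; rewrite mxE.
    apply: cvg_sum_fin => l; apply: cvgM; first exact: cvg_cst.
    by apply: cvg_entry; exact: cvg_snd.
  exact: (@cvg_pair _ _ _ _ _ _ (nbhs_filter x) _ _ _ _ cvg_fst c2).
apply/seteqP; split=> F; rewrite /fr_base /preimage /mkset val_fr_act// frame_coord_act; exact: id.
Qed.

Local Open Scope quotient_scope.
Local Notation Gamma2 := (Gamma2 omega J).

Lemma Gamma2_eqP (F F' : Fr) : \pi_Gamma2 F = \pi_Gamma2 F' ->
  exists2 C, eu_group C & val F' = frame_act (val F) C.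
Proof. by move=> /eqmodP/asboolP. Qed.

(** The saturation of [O] is the union of its preimages under the homeomorphic actions of the
    elements of [eu_group]. *)
Lemma Gamma2_pi_open (O : set Fr) : open O -> open (\pi_Gamma2 @` O).
Proof.
move=> oO; rewrite /open /= /quotient_open.
have -> : \pi_Gamma2 @^-1` (\pi_Gamma2 @` O) =
    \bigcup_(C in @eu_group R n) (fr_act C @^-1` O).
  apply/seteqP; split=> [F [G OG /esym /Gamma2_eqP[C euC E]]|F [C euC OF]].
    exists C => //=; suff -> : fr_act C F = G by [].
    by apply: val_inj; rewrite val_fr_act ?E//; case: euC.
  exists (fr_act C F) => //; apply/esym/eqmodP/asboolP; exists C => //.
  by rewrite val_fr_act//; case: euC.
apply: bigcup_open => C [uC _]; move/continuousP: (fr_act_continuous uC); exact.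
Qed.

Lemma Gamma2_pi_nbhs (F : Fr) (P : set Fr) :
  nbhs F P -> nbhs (\pi_Gamma2 F) (\pi_Gamma2 @` P).
Proof.
rewrite nbhsE => -[U [oU UF] UP].
rewrite nbhsE; exists (\pi_Gamma2 @` U); last exact: image_subset.
by split; [exact: Gamma2_pi_open|exists F].
Qed.

(** The matrix of products [g_J(X_j, Y_k)] at [p], where the rows of [X] and [Y] are coordinate
    vectors in chart [i] and [W] holds the metric coefficients. *)
Definition gram (i : chart_idx M) (W : 'I_(n + n) -> 'I_(n + n) -> 'rV[R]_(n + n) -> R)
    (p : M) (X Y : 'M[R]_(n + n)) : 'M[R]_(n + n) :=
  \matrix_(j, k) \sum_a \sum_b X j a * Y k b * W a b (chart i p).

Lemma frame_act_gram_chart i W (F : Fr) C :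
  tensor2_expr (acs_metric omega J) i W -> chart_dom i (fr_base F) ->
  C = gram i W (fr_base F) (frame_coord i (val F)) (frame_coord i (frame_act (val F) C)).
Proof.
move=> [_ gW]; rewrite /fr_base => iF.
have /asboolP := valP F; move: (val F) iF => [p f] /= ip uf.
apply/matrixP => j k; rewrite mxE.
rewrite (@frame_act_gram _ _ _ _ _ hJ p f (fun k => \sum_l C l k *: f l) C uf)//.
rewrite gW//; apply: eq_bigr => a _; apply: eq_bigr => b _.
by rewrite !mxE.
Qed.

(** The variable [q] is a pair of points of the local trivialization, one for each of two frames; at
    two frames with the same base point the function gives the squared determinant of their
    transition matrix. *)
Lemma detC_gram_continuous i W p X Y :
  tensor2_expr (acs_metric omega J) i W -> chart_dom i p ->
  {for ((p, X), (p, Y)), continuous (fun q : (M * 'M[R]_(n + n)) * (M * 'M[R]_(n + n)) =>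
     detC (gram i W q.1.1 q.1.2 q.2.2) ^+ 2 : Cplx R)}.
Proof.
move=> [sW _] ip; set q0 := ((p, X), (p, Y)).
have FF := nbhs_filter q0.
pose Q := ((M * 'M[R]_(n + n)) * (M * 'M[R]_(n + n)))%type.
have c1 : (fun q : Q => q.1) @ q0 --> (p, X) by exact: cvg_fst.
have c2 : (fun q : Q => q.2) @ q0 --> (p, Y) by exact: cvg_snd.
have cp : (fun q : Q => q.1.1) @ q0 --> p by apply: cvg_comp c1 _; exact: cvg_fst.
have cX : (fun q : Q => q.1.2) @ q0 --> X by apply: cvg_comp c1 _; exact: cvg_snd.
have cY : (fun q : Q => q.2.2) @ q0 --> Y by apply: cvg_comp c2 _; exact: cvg_snd.
have cchart : {for p, continuous (chart i)}.
  have := @chart_continuous _ _ M i; rewrite continuous_open_subspace; last exact: chart_dom_open.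
  by apply; rewrite inE.
have cW a b : (fun q : Q => W a b (chart i q.1.1)) @ q0 --> W a b (chart i p).
  apply: (continuous_cvg FF (f := fun q : Q => chart i q.1.1)); last exact: (continuous_cvg FF cchart cp).
  by have [+ _] := sW a b 0%N; apply; rewrite inE; exists p.
suff c : (fun q : Q => detC (gram i W q.1.1 q.1.2 q.2.2)) @ q0 --> detC (gram i W p X Y).
  exact: (@cvgM _ _ _ FF _ _ _ _ c c).
apply: cvg_detC; apply: cvg_mx_entry => j k; rewrite mxE; under eq_cvg do rewrite mxE.
apply: cvg_sum_fin => a; apply: cvg_sum_fin => b.
by apply: (@cvgM _ _ _ FF) => //; apply: (@cvgM _ _ _ FF); exact: cvg_entry.
Qed.

End FrameBundle.

(** * Comparison of trivializations *)

Section Trivialization.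
Variables (R : realType) (n : nat) (M : smoothManifold R (n + n)).
Variables (omega : symplectic_form M) (J : almost_complex M).
Hypothesis hJ : compatible omega J.
Local Open Scope quotient_scope.
Local Notation Fr := (Fr omega J).
Local Notation Gamma2 := (Gamma2 omega J).
Implicit Types (F G : Fr) (C : 'M[R]_(n + n)) (s : global_section omega J).

Lemma norm_detC C : unitary_group C -> `|detC C| = 1.
Proof.
move=> [A [B [-> /unitary_inv[_ AB _]]]]; rewrite detC_real_mx.
move/(congr1 determinant): AB; rewrite det_mulmx det1 cpx_mx_adj det_map_mx det_tr.
by rewrite -normCK => /eqP; rewrite sqrp_eq1// => /eqP.
Qed.

Lemma fr_base_act F G C : val G = frame_act (val F) C -> fr_base G = fr_base F.
Proof. by rewrite /fr_base => ->. Qed.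

Lemma gamma_base_pi F : gamma_base (\pi_Gamma2 F) = fr_base F.
Proof.
rewrite /gamma_base.
have /Gamma2_eqP[C _] : \pi_Gamma2 F = \pi_Gamma2 (repr (\pi_Gamma2 F)) by rewrite reprK.
exact: fr_base_act.
Qed.

Lemma frames_related F G : fr_base F = fr_base G ->
  exists2 C, unitary_group C & val G = frame_act (val F) C.
Proof.
rewrite /fr_base; have /asboolP := valP F; have /asboolP := valP G.
move: (val F) (val G) => [p f] [q f'] /= uf' uf pq; case: _ / pq f' uf' => f' uf'.
exact: (unitary_frames_related hJ uf uf').
Qed.

(** Both matrices equal the Gram matrix of [F] against the common image frame. *)
Lemma frame_act_inj F C D : frame_act (val F) C = frame_act (val F) D -> C = D.
Proof.
have [i iF] := chart_dom_cover (fr_base F).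
have [[_ /(_ i)[W gW]] _ _] := hJ => CD.
by rewrite (frame_act_gram_chart hJ C gW iF) CD -(frame_act_gram_chart hJ D gW iF).
Qed.

(** Changing the representatives of the two classes multiplies the transition matrix by elements of
    [eu_group], whose squared determinant is 1. Hence any pair that [xget] may select has the same
    circle component. *)
Lemma trivializationE s F G C : s (fr_base G) = \pi_Gamma2 F ->
  unitary_group C -> val G = frame_act (val F) C ->
  val (trivialization s (\pi_Gamma2 G)).2 = detC C ^+ 2.
Proof.
move=> sF uC GE.
have dC : detC C ^+ 2 \in [set z : Cplx R | `|z| = 1].
  by rewrite inE /= normrX norm_detC// expr1n.
pose z : S1 R := exist _ (detC C ^+ 2) dC.
pose A := [set pz : M * S1 R | gamma_act (s pz.1) pz.2 (\pi_Gamma2 G)].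
have : A (trivialization s (\pi_Gamma2 G)).
  (* The given [C] shows that the set is inhabited, so the default value of [trivialization] is not
     taken. *)
  by apply: xgetPex; exists (fr_base G, z); exists F, G, C.
case: (trivialization _ _) => q w [F1 [G1 [C1 [uC1 <- G1E sF1 GG1]]]] /=.
have qG : q = fr_base G.
  rewrite -(gsec_base s q) sF1 gamma_base_pi -(fr_base_act G1E).
  by rewrite -gamma_base_pi -GG1 gamma_base_pi.
move: sF1; rewrite /= qG sF => /Gamma2_eqP[D euD F1E].
have [E euE G1E'] := Gamma2_eqP GG1.
(* Both products carry [F] to [G1], through [G] and through [F1] respectively. *)
have : C *m E = D *m C1.
  by apply: (@frame_act_inj F); rewrite -!frame_actM -GE -F1E -G1E.
move=> /(congr1 (fun X => detC X ^+ 2)).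
rewrite !detCM//; [|by case: euD|by case: euE].
by rewrite !exprMn (eu_detC_sqr euD) (eu_detC_sqr euE) mul1r mulr1.
Qed.

Lemma gsec_pi s p : exists2 F : Fr, s p = \pi_Gamma2 F & fr_base F = p.
Proof. by exists (repr (s p)); [rewrite reprK|exact: gsec_base]. Qed.

(** The circle element [w(p)] with [s'(p) = s(p).w(p)], regarded as a complex number. *)
Definition section_ratio s s' (p : M) : Cplx R := val (trivialization s (s' p)).2.

(** Choose frames [F], [F'], [G] over one point for [s], [s'] and [y]. If [F' = F C] and [G = F' D],
    then [G = F (C D)], and the squared determinant is multiplicative. *)
Lemma trivialization_ratio s s' (y : Gamma2) :
  val (trivialization s y).2 =
  section_ratio s s' (gamma_base y) * val (trivialization s' y).2.
Proof.
rewrite -(reprK y) gamma_base_pi; move: (repr y) => G; set p := fr_base G.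
have [F sF Fp] := gsec_pi s p; have [F' sF' F'p] := gsec_pi s' p.
have [C uC F'E] := frames_related (etrans Fp (esym F'p)).
have [D uD GE] := frames_related F'p.
rewrite /section_ratio sF' (trivializationE _ uC F'E) ?F'p//.
rewrite (trivializationE sF' uD GE).
rewrite (@trivializationE s F G (C *m D)) ?detCM ?exprMn//.
  by have [_ + _] := @unitary_group_subgroup R n; exact.
by rewrite GE F'E frame_actM.
Qed.

Lemma section_ratio_continuous s s' : continuous (section_ratio s s').
Proof.
move=> p; have [F0 sF0 F0p] := gsec_pi s p; have [F0' sF0' F0p'] := gsec_pi s' p.
have [i ip] := chart_dom_cover p.
have [[_ /(_ i)[W gW]] _ _] := hJ.
pose loc F := (fr_base F, frame_coord i (val F)).
pose delta (q : (M * 'M[R]_(n + n)) * (M * 'M[R]_(n + n))) : Cplx R :=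
  detC (gram i W q.1.1 q.1.2 q.2.2) ^+ 2.
(* The formula holds for all representatives of [s q] and [s' q], which leaves them free to be
   chosen close to [F0] and [F0']. *)
have ratioE q (F F' : Fr) : chart_dom i q -> fr_base F = q -> fr_base F' = q ->
    s q = \pi_Gamma2 F -> s' q = \pi_Gamma2 F' ->
    section_ratio s s' q = delta (loc F, loc F').
  move=> iq Fq F'q sF sF'.
  have [C uC F'E] := frames_related (etrans Fq (esym F'q)).
  rewrite /section_ratio sF' (trivializationE _ uC F'E) ?F'q//.
  by rewrite -Fq in iq; rewrite {1}(frame_act_gram_chart hJ C gW iq) -F'E.
move=> V; rewrite /= (ratioE p F0 F0')// => nV.
have dc : {for (loc F0, loc F0'), continuous delta}.
  by rewrite /loc F0p F0p'; exact: (detC_gram_continuous gW ip).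
have [[A A'] [/= nA nA'] AAV] := dc V nV.
have iF0 : chart_dom i (fr_base F0) by rewrite F0p.
have iF0' : chart_dom i (fr_base F0') by rewrite F0p'.
(* Openness of the quotient map replaces local sections: classes of frames near [F0] fill a
   neighbourhood of [s p], so for [q] near [p] the class [s q] has a representative near [F0]. The
   same holds for [s']. *)
have nP := Gamma2_pi_nbhs hJ (fr_trivialization_continuous iF0 nA).
have nP' := Gamma2_pi_nbhs hJ (fr_trivialization_continuous iF0' nA').
rewrite -sF0 in nP; rewrite -sF0' in nP'.
have cs := gsec_continuous nP; have cs' := gsec_continuous nP'.
have ni : nbhs p (chart_dom i) by apply: open_nbhs_nbhs; split=> //; exact: chart_dom_open.
apply: (@filterS3 _ _ (nbhs_filter p) _ _ _ _ _ cs cs' ni) => q [F AF sF] [F' AF' sF'] iq.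
have Fq : fr_base F = q by rewrite -gamma_base_pi sF gsec_base.
have F'q : fr_base F' = q by rewrite -gamma_base_pi sF' gsec_base.
by rewrite /= (ratioE q F F')//; apply: AAV.
Qed.

Lemma norm_S1 (z : S1 R) : `|val z| = 1.
Proof. by have := valP z; rewrite inE. Qed.

Definition lambda_base : Lambda omega J -> M := @fr_base R n M omega J \o repr.

Lemma lambda_base_continuous : continuous lambda_base.
Proof.
apply: repr_comp_continuous; first exact: continuous_fr_base.
by move=> F F' /eqP/eqmodP/asboolP[C _ E]; apply/eqP/esym/(fr_base_act E).
Qed.

Lemma gamma_base_det2 (x : Lambda omega J) : gamma_base (det2 x) = lambda_base x.
Proof. exact: gamma_base_pi. Qed.

End Trivialization.

(** * Loops in a simply connected base and invariance of the degree *)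

Lemma circ_continuous (R : realType) : continuous (@circ R).
Proof.
apply: continuous_comp_initial => t; apply: cvg_complex.
  apply: continuous_comp; last exact: continuous_cos.
  by apply: cvgM; [exact: cvg_cst|exact: cvg_id].
apply: continuous_comp; last exact: continuous_sin.
by apply: cvgM; [exact: cvg_cst|exact: cvg_id].
Qed.

Lemma cis1 (R : realType) : cis (1 : R) = 1.
Proof. by rewrite /cis mulr1 mulr_natl cos2pi sin2pi. Qed.

(** Composing [w] with a null-homotopy of [f] gives a homotopy of circle-valued loops to a constant
    one, from which the logarithm is carried back. *)
Lemma simply_connected_loop_log (R : realType) (T : topologicalType)
    (w : T -> Cplx R) (f : R -> T) :
  simply_connected R T -> continuous w -> (forall x, `|w x| = 1) ->
  continuous f -> f 0 = f 1 -> exists phi, loop_log (w \o f) phi.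
Proof.
move=> [_ null] cw w1 cf f01.
have [H [cH H0 H1 Hs]] := null (f 0) f (continuous_subspaceT cf) erefl (esym f01).
(* The parameter is reversed because [H] is constant at 1, whereas [homotopy_loop_log] starts from
   the loop at 0. *)
pose c (x : R * R) : R * R := (clamp (1 - x.1), clamp x.2).
have cc : continuous c.
  move=> x.
  have c1 : (fun y : R * R => clamp (1 - y.1)) @ x --> clamp (1 - x.1).
    have c1 : (fun y : R * R => 1 - y.1) @ x --> 1 - x.1.
      by apply: (@cvgB _ _ _ _ (nbhs_filter x)); [exact: cvg_cst|exact: cvg_fst].
    exact: (continuous_cvg (nbhs_filter x) (continuous_clamp (x := 1 - x.1)) c1).
  have c2 : (fun y : R * R => clamp y.2) @ x --> clamp x.2.
    have c2 : (fun y : R * R => y.2) @ x --> x.2 by exact: cvg_snd.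
    exact: (continuous_cvg (nbhs_filter x) (continuous_clamp (x := x.2)) c2).
  exact: (@cvg_pair _ _ _ _ _ _ (nbhs_filter x) _ _ _ _ c1 c2).
have I0 : `[0, 1]%classic (0 : R) by rewrite /= in_itv /= lexx ler01.
have I1 : `[0, 1]%classic (1 : R) by rewrite /= in_itv /= lexx ler01.
have Ic x : (`[0, 1]%classic `*` `[0, 1]%classic) (c x) by split; exact: clamp_itv.
(* [H] is continuous only within the square, but [c] takes all its values there. *)
have cHc : continuous (H \o c).
  move=> x; move/subspace_continuousP: cH => /(_ _ (Ic x)) cH.
  apply: (cvg_comp c H _ cH) => V nV; have := cc x _ nV.
  by apply: (@filterS _ _ (nbhs_filter x)) => y Vy; exact: Vy (Ic y).
have [phi hphi] : exists phi, loop_log (fun t => w (H (c (1, t)))) phi.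
  apply: (@homotopy_loop_log R (w \o (H \o c))).
  - by move=> x; apply: continuous_comp; [exact: cHc|exact: cw].
  - by move=> x; exact: w1.
  - by move=> s t; rewrite /= /c /= (clamp_id (clamp_itv t)).
  - move=> s; have [Hs0 Hs1] := Hs _ (clamp_itv (1 - s)).
    by rewrite /= /c /= (clamp_id I0) (clamp_id I1) Hs0 Hs1.
  - have [t0 t0E] := cis_surj (w1 (f 0)).
    exists (fun=> t0); split=> //; first by move=> ?; exact: cvg_cst.
    by move=> t It; rewrite /= /c /= subr0 (clamp_id I1) (clamp_id It) H1.
exists phi; case: hphi => cphi phi01 phiE; split=> // t It.
by rewrite -phiE// /c /= subrr (clamp_id I0) (clamp_id It) H0.
Qed.

Lemma is_degree_mul (R : realType) (h h' : S1 R -> S1 R) (w : R -> Cplx R) phi d :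
  loop_log w phi ->
  (forall t, val (h (circ t)) = w t * val (h' (circ t))) ->
  is_degree h' d -> is_degree h d.
Proof.
move=> [cphi phi01 wE] hE [theta [ctheta thetaE thetad]].
exists (fun t => phi t + theta t); split.
- move=> t; apply: cvgD; last exact: ctheta.
  by apply: continuous_subspaceT.
- by move=> t It; apply: val_inj; rewrite hE wE// thetaE// /= cisD.
- by rewrite -thetad phi01; ring.
Qed.

Theorem proposition9 (R : realType) (n : nat) (M : smoothManifold R (n + n))
    (omega : symplectic_form M) (J : almost_complex M)
    (hJ : compatible omega J) (hM : simply_connected R M)
    (gamma : S1 R -> Lambda omega J) (hgamma : continuous gamma)
    (s s' : global_section omega J) :
  maslov_index s gamma = maslov_index s' gamma.
Proof.
pose f (t : R) := lambda_base (gamma (circ t)).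
have cf : continuous f.
  move=> t; apply: (@continuous_comp _ _ _ (@circ R) (lambda_base (J := J) \o gamma)).
    exact: circ_continuous.
  by apply: continuous_comp; [exact: hgamma|exact: lambda_base_continuous].
have f01 : f 0 = f 1.
  by rewrite /f; congr (lambda_base (gamma _)); apply: val_inj; rewrite /= cis0 cis1.
(* [degree] selects from the set of integers satisfying [is_degree], so it suffices that both
   sections give the same set. Stating the implication for an arbitrary ordered pair of sections
   yields both inclusions. *)
have deg_imp (s1 s2 : global_section omega J) d :
    is_degree (snd \o trivialization s2 \o det2 (J := J) \o gamma) d ->
    is_degree (snd \o trivialization s1 \o det2 (J := J) \o gamma) d.
  have w1 x : `|section_ratio s1 s2 x| = 1 by exact: norm_S1.
  have [phi hphi] := simply_connected_loop_log hM
    (section_ratio_continuous hJ (s := s1) (s' := s2)) w1 cf f01.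
  apply: (is_degree_mul hphi) => t.
  by rewrite /= (trivialization_ratio hJ s1 s2) gamma_base_det2.
rewrite /maslov_index /degree; congr xget.
by apply/seteqP; split=> d; exact: deg_imp.
Qed.
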